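(* Every data structure in the Word RAM model that maintains an unweighted rooted forest with $n$ vertices under the operations \textsf{subtree-sum} and \textsf{cut} requires $\Omega\!\left(n\frac{\log n}{\log\log n}\right)$ time for $n$ operations.
   Context: Operations: $\textsf{cut}(v)$ deletes the edge between $v$ and its parent (legal only if $v$ is not a root); $\textsf{subtree-sum}(v)$ returns the number of vertices in the subtree of the current forest rooted at $v$. The Word RAM has words of $\Theta(\log n)$ bits. *)

(* Defs.v *)
(* Cell-probe abstraction of the Word RAM. *)
From mathcomp Require Import all_boot.
Set Implicit Arguments. Unset Strict Implicit. Unset Printing Implicit Defensive.

Definition word (w : nat) := 'I_(2 ^ w).
Definition memory (w : nat) := word w -> word w.

Definition upd w (m : memory w) (a x : word w) : memory w :=
  fun b => if b == a then x else m b.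

(** An operation's algorithm: an adaptive (decision-tree) program whose only
    charged steps are memory reads and writes of single words. *)
Inductive probe (w : nat) (A : Type) : Type :=
| PDone : A -> probe w A
| PRead : word w -> (word w -> probe w A) -> probe w A
| PWrite : word w -> word w -> probe w A -> probe w A.
Arguments PDone {w A}.
Arguments PRead {w A}.
Arguments PWrite {w A}.

Fixpoint run w A (t : probe w A) (m : memory w) : A * memory w * nat :=
  match t with
  | PDone x => (x, m, 0)
  | PRead a k => let '(x, m', c) := run (k (m a)) m in (x, m', c.+1)
  | PWrite a v t' => let '(x, m', c) := run t' (upd m a v) in (x, m', c.+1)
  end.

(** * Rooted forests on the vertex set 'I_n, given by a parent function
      (None = root). *)
Definition parent_fn n := 'I_n -> option 'I_n.
Definition up n (p : parent_fn n) (o : option 'I_n) : option 'I_n := obind p o.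

(** acyclic: climbing n times from any vertex falls off a root *)
Definition is_forest n (p : parent_fn n) : Prop :=
  forall v, iter n (up p) (Some v) = None.

Definition in_subtree n (p : parent_fn n) (v u : 'I_n) : bool :=
  [exists k : 'I_n.+1, iter k (up p) (Some u) == Some v].

Definition subtree_sum n (p : parent_fn n) (v : 'I_n) : nat :=
  #|[set u | in_subtree p v u]|.

Definition cut_forest n (p : parent_fn n) (v : 'I_n) : parent_fn n :=
  fun u => if u == v then None else p u.

Inductive op (n : nat) : Type :=
| Cut of 'I_n
| SubtreeSum of 'I_n.
Arguments Cut {n}.
Arguments SubtreeSum {n}.

Fixpoint legal n (p : parent_fn n) (s : seq (op n)) : Prop :=
  match s with
  | [::] => True
  | Cut v :: s' => p v <> None /\ legal (cut_forest p v) s'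
  | SubtreeSum _ :: s' => legal p s'
  end.

(** A data structure for forests on n vertices with w-bit words.
    The initial memory image may depend arbitrarily on the initial forest
    (preprocessing is not charged). *)
Record DS (n w : nat) := {
  ds_init : parent_fn n -> memory w;
  ds_cut : 'I_n -> probe w unit;
  ds_sum : 'I_n -> probe w nat }.

Fixpoint exec n w (D : DS n w) (m : memory w) (p : parent_fn n)
    (s : seq (op n)) : bool * nat :=
  match s with
  | [::] => (true, 0)
  | Cut v :: s' =>
      let '(_, m', c) := run (ds_cut D v) m in
      let '(ok, c') := exec D m' (cut_forest p v) s' in (ok, c + c')
  | SubtreeSum v :: s' =>
      let '(a, m', c) := run (ds_sum D v) m in
      let '(ok, c') := exec D m' p s' in
      ((a == subtree_sum p v) && ok, c + c')
  end.

Definition correct n w (D : DS n w) : Prop :=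
  forall p : parent_fn n, is_forest p ->
  forall s, legal p s -> (exec D (ds_init D p) p s).1.

Definition cost n w (D : DS n w) (p : parent_fn n) (s : seq (op n)) : nat :=
  (exec D (ds_init D p) p s).2.

(* Main.v *)
Require Import Defs.
From mathcomp Require Import all_boot zify.
Set Implicit Arguments. Unset Strict Implicit. Unset Printing Implicit Defensive.

(* Chronogram method of Fredman and Saks, against a deterministic adversary.  The forest is a caterpillar whose spine vertex [m + y] carries one leaf per position [y < m], with [m = 2 ^ k] of order [n].  At time [t < m] the adversary asks the currently most expensive query, then cuts the leaf at the bit reversal of [t] if [t \in x]; costs are summed over all inputs [x].  Time is cut into nested aligned intervals whose lengths are powers of [2 ^ be], where [be] is about [3 log log n]; let [s <= c <= t] be the starts of the intervals around [t] at two consecutive levels.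

   If few queries at time [t] read a cell changed in the epoch [s, c) but not in [c, t), then [x] is determined, up to a small Hamming ball, by its part outside the epoch and the cells changed in [c, t): the bit of a step of the epoch is the difference of two subtree sums, since bit reversal spreads the cut leaves of the epoch evenly.  As [c, t) is polylogarithmically shorter than the epoch, counting rules this out for half of the [x] unless [c, t) was already very expensive.  So at each level a typical query reads such a cell, and these cells are distinct for distinct levels. *)

(** * Cells read and cells changed by a probe program *)

Section Probes.
Variable w : nat.

Fixpoint reads A (t : probe w A) (m : memory w) : seq (word w) :=
  match t with
  | PDone _ => [::]
  | PRead a k => a :: reads (k (m a)) m
  | PWrite a v t' => reads t' (upd m a v)
  end.

Lemma size_reads A (t : probe w A) m : size (reads t m) <= (run t m).2.
Proof.
elim: t m => [x|a k IH|a v t IH] m //=.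
- by have := IH (m a) m; case: (run _ _) => [[x m'] c].
- by have := IH (upd m a v); case: (run _ _) => [[x m'] c] /= /leqW.
Qed.

(** Agreement on the cells read by the first run is enough: by induction both runs take the same
    branches. *)
Lemma run_agree A (t : probe w A) (m1 m2 : memory w) :
  {in reads t m1, m1 =1 m2} -> (run t m1).1.1 = (run t m2).1.1.
Proof.
elim: t m1 m2 => [x|a k IH|a v t IH] m1 m2 //= E.
- have Ea : m1 a = m2 a by apply: E; rewrite inE eqxx.
  have := IH (m1 a) m1 m2; rewrite -Ea.
  case: (run _ m1) => [[x1 m1'] c1]; case: (run _ m2) => [[x2 m2'] c2] /=.
  by apply=> b b_in; apply: E; rewrite inE b_in orbT.
- have := IH (upd m1 a v) (upd m2 a v).
  case: (run _ (upd m1 _ _)) => [[x1 m1'] c1].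
  case: (run _ (upd m2 _ _)) => [[x2 m2'] c2] /=.
  by apply=> b b_in; rewrite /upd; case: eqP => // _; apply: E.
Qed.

Lemma card_run_changed A (t : probe w A) m :
  #|[set a | (run t m).1.2 a != m a]| <= (run t m).2.
Proof.
elim: t m => [x|a k IH|a v t IH] m /=.
- by rewrite leqn0 cards_eq0; apply/eqP/setP=> a; rewrite !inE eqxx.
- by have := IH (m a) m; case: (run _ _) => [[x m'] c] /= /leqW.
- have := IH (upd m a v); case: (run _ _) => [[x m'] c] /= le_c.
  apply: (@leq_trans #|a |: [set b | m' b != upd m a v b]|).
    apply/subset_leq_card/subsetP=> b; rewrite !inE /upd.
    by case: (b == a).
  by rewrite cardsU1; case: (_ \notin _); rewrite ?add1n ?add0n // leqW.
Qed.

End Probes.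

(** * Counting: fibres, small sets and Hamming balls *)

Lemma card_le_fibres (T F : finType) (f : T -> F) (X : {set T}) (Y : {set F}) q :
  (forall x, x \in X -> f x \in Y) ->
  (forall y, #|[set x in X | f x == y]| <= q) -> #|X| <= #|Y| * q.
Proof.
move=> XY fib; rewrite -sum1_card (partition_big f (mem Y)) //=.
rewrite -sum_nat_const; apply: leq_sum => y _.
rewrite sum1_card; apply: leq_trans (fib y).
by apply/subset_leq_card/subsetP=> x; rewrite !inE.
Qed.

Lemma card_small_sets (T : finType) W :
  #|[set A : {set T} | #|A| <= W]| <= #|T|.+1 ^ W.
Proof.
rewrite -card_option -card_tuple.
pose f (s : W.-tuple (option T)) := [set a | Some a \in (s : seq _)].
rewrite -cardsT; apply: leq_trans (leq_imset_card f _).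
apply/subset_leq_card/subsetP=> A; rewrite inE => leA.
pose s := [seq Some a | a <- enum A] ++ nseq (W - #|A|) None.
have sz : size s == W.
  by rewrite size_cat size_map size_nseq -cardE subnKC.
apply/imsetP; exists (Tuple sz); rewrite ?inE //.
apply/setP=> a; rewrite inE /= mem_cat mem_nseq andbF orbF.
by rewrite mem_map ?mem_enum // => u v [].
Qed.

Lemma leq_exp2rW a b e : a <= b -> a ^ e <= b ^ e.
Proof. by case: e => // e; rewrite leq_exp2r. Qed.

(** In the binomial expansion of [(16 + 1) ^ r] every term of index at most [r %/ 16] carries a
    weight of at least [16 ^ (r - r %/ 16)]. The bound is squared so that no exponent is halved. *)
Lemma card_hamming_ball (T : finType) (S : {set T}) :
  #|[set E : {set T} | (E \subset S) && (16 * #|E| <= #|S|)]| ^ 2 <= 2 ^ #|S|.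
Proof.
set r := #|S|; set V := #|_|.
have V_sum D : 16 * D <= r -> (forall j, 16 * j <= r -> j <= D) ->
    V * 16 ^ (r - D) <= 17 ^ r.
  move=> leDr maxD; rewrite -[17]/(16 + 1) expnDn.
  have -> : V = \sum_(j < r.+1) if j <= D then 'C(r, j) else 0.
    rewrite /V -sum1_card.
    rewrite (partition_big (fun E : {set T} => inord #|E| : 'I_r.+1) predT) //=.
    apply: eq_bigr => j _; rewrite sum1_card.
    have lt_card (E : {set T}) : E \subset S -> #|E| < r.+1.
      by rewrite ltnS; apply: subset_leq_card.
    case: leqP => leD.
      rewrite -(cards_draws S j); apply: eq_card => E; rewrite !inE unfold_in /= !inE.
      case sE: (E \subset S) => //=.
      rewrite -val_eqE /= inordK ?lt_card //.
      case: eqP => [->|_]; rewrite ?andbF ?andbT //.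
      by lia.
    apply: eq_card0 => E; rewrite !inE unfold_in /= !inE.
    case sE: (E \subset S) => //=.
    rewrite -val_eqE /= inordK ?lt_card //.
    case: leqP => //= /maxD leE; apply/eqP => eE; move: leE leD; rewrite eE; lia.
  rewrite big_distrl /=; apply: leq_sum => j _.
  rewrite exp1n muln1; case: (leqP j D) => // leD.
  by rewrite leq_mul2l leq_pexp2l ?orbT // leq_sub2l.
have leD : 16 * (r %/ 16) <= r by lia.
have maxD j : 16 * j <= r -> j <= r %/ 16 by lia.
have {V_sum leD maxD} HV := V_sum _ leD maxD.
have {}HV : V * 16 ^ r <= 17 ^ r * 16 ^ (r %/ 16).
  apply: leq_trans (leq_mul HV (leqnn _)).
  by rewrite -mulnA -expnD subnK //; lia.
have pos16 : 0 < 16 ^ (16 * r) by rewrite expn_gt0.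
(* Sixteenth powers remove the quotient [r %/ 16]; then [17 ^ 16 <= 4 * 16 ^ 16] suffices. *)
have HV16 : V ^ 16 * 16 ^ (16 * r) <= 2 ^ (8 * r) * 16 ^ (16 * r).
  have := leq_exp2r (V * 16 ^ r) (17 ^ r * 16 ^ (r %/ 16)) (isT : 0 < 16).
  rewrite HV !expnMn -!expnM (mulnC r 16) => H.
  apply: (leq_trans H); rewrite expnM.
  apply: (@leq_trans ((4 * 16 ^ 16) ^ r * 16 ^ r)).
    apply: leq_mul; first by apply: leq_exp2rW; lia.
    by rewrite leq_pexp2l //; lia.
  rewrite expnMn -expnM mulnAC leq_mul2r; apply/orP; right.
  have -> : 16 ^ r = 2 ^ (4 * r) by rewrite expnM.
  have -> : 4 ^ r = 2 ^ (2 * r) by rewrite expnM.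
  by rewrite -expnD leq_pexp2l //; lia.
move: HV16; rewrite leq_mul2r (gtn_eqF pos16) /= => HV16.
rewrite -(@leq_exp2r _ _ 8) // -!expnM mulnC.
by rewrite (mulnC r 8).
Qed.

(** * Bit reversal *)

Fixpoint bitrev (k t : nat) : nat :=
  if k is k'.+1 then t %% 2 * 2 ^ k' + bitrev k' (t %/ 2) else 0.

Lemma bitrev_lt k t : bitrev k t < 2 ^ k.
Proof.
elim: k t => // k IH t /=; rewrite expnS.
have := IH (t %/ 2); have : t %% 2 < 2 by rewrite ltn_mod.
case: (t %% 2) => [|[|?]] //; lia.
Qed.

Lemma bitrev_inj k t1 t2 :
  t1 < 2 ^ k -> t2 < 2 ^ k -> bitrev k t1 = bitrev k t2 -> t1 = t2.
Proof.
elim: k t1 t2 => [|k IH] t1 t2 /=; first by case: t1; case: t2.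
rewrite expnS => lt1 lt2 E.
have l1 := bitrev_lt k (t1 %/ 2); have l2 := bitrev_lt k (t2 %/ 2).
have E2 : t1 %% 2 = t2 %% 2.
  have := congr1 (divn ^~ (2 ^ k)) E.
  by rewrite !divnMDl ?expn_gt0 // (divn_small l1) (divn_small l2) !addn0.
rewrite E2 in E; have {}E := addnI E.
have E1 : t1 %/ 2 = t2 %/ 2.
  by apply: IH => //; rewrite ltn_divLR // mulnC.
by rewrite (divn_eq t1 2) (divn_eq t2 2) E1 E2.
Qed.

(** Equal quotients by [2 ^ e] mean equal upper bits, and reversal turns those into the [k - e]
    lowest bits. *)
Lemma bitrev_mod k e t1 t2 : e <= k -> t1 %/ 2 ^ e = t2 %/ 2 ^ e ->
  bitrev k t1 = bitrev k t2 %[mod 2 ^ (k - e)].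
Proof.
elim: k e t1 t2 => [|k IH] [|e] t1 t2 // lek.
  by rewrite !divn1 => ->.
rewrite expnS !divnMA => E /=; rewrite subSS.
have dv : 2 ^ (k - e) %| 2 ^ k by rewrite dvdn_exp2l // leq_subr.
have kill a b : a * 2 ^ k + b = b %[mod 2 ^ (k - e)].
  by rewrite -modnDml (eqP (dvdn_mull a dv)) add0n.
by rewrite !kill; apply: IH.
Qed.

(* In an aligned time interval of length [2 ^ e] the positions written are spread with period exactly [2 ^ (k - e)]. *)
Lemma bitrev_sep k e t1 t2 : e <= k -> t1 < 2 ^ k -> t2 < 2 ^ k ->
  t1 %/ 2 ^ e = t2 %/ 2 ^ e ->
  bitrev k t1 < bitrev k t2 + 2 ^ (k - e) ->
  bitrev k t2 < bitrev k t1 + 2 ^ (k - e) -> t1 = t2.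
Proof.
move=> lek lt1 lt2 E l1 l2; apply: (bitrev_inj lt1 lt2).
have := bitrev_mod lek E; move: l1 l2.
wlog le12 : t1 t2 lt1 lt2 E / bitrev k t1 <= bitrev k t2.
  move=> H l1 l2 M; have [le|/ltnW le] := leqP (bitrev k t1) (bitrev k t2).
    exact: H.
  by apply/esym/H.
move=> _ l2 /eqP; rewrite eq_sym eqn_mod_dvd // => /dvdnP[q Eq].
move: Eq l2; case: q => [|q]; rewrite ?mulSn; lia.
Qed.

(** * Encoding argument for a single epoch *)

Section Epoch.
(* [m = 2 ^ k] time steps; the epoch is the time interval [s, c) inside an aligned interval of length [2 ^ e]; the queries are asked at time [t >= c].  [Ms x] and [Mt x] are the memories at times [s] and [t], [Chg x] the cells changed in [c, t) and [Old x] those changed in [s, c). *)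
Variables (w k e s c t W : nat).
Notation m := (2 ^ k).
Notation bw := (2 ^ (k - e)).
Variables (Ms Mt : {set 'I_m} -> memory w) (Chg Old : {set 'I_m} -> {set word w}).
Variables (qry : nat -> probe w nat) (F : nat -> nat).
Notation S := [set i : 'I_m | s <= i < c].
Notation r := (c - s).

Hypothesis le_ek : e <= k.
Hypothesis node : forall i : nat, s <= i < c -> i %/ 2 ^ e = s %/ 2 ^ e.
Hypotheses (le_ct : c <= t) (le_cm : c <= m) (r_big : 2 ^ e <= 2 * r).
Hypothesis Ms_prefix : forall x1 x2 : {set 'I_m}, x1 :\: S = x2 :\: S -> Ms x1 =1 Ms x2.
Hypothesis Mt_frame : forall x a, a \notin Chg x -> a \notin Old x -> Mt x a = Ms x a.
Hypothesis ans : forall x v, v < 3 * m ->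
  (run (qry v) (Mt x)).1.1
    + #|[set i : 'I_m in x | (i < t) && (m + bitrev k i <= v)]| = F v.

(** A query without such a read sees only cells whose content is either listed in [chg_graph x] or
    unchanged since time [s]. *)
Definition probes_epoch x v :=
  has (fun a => (a \in Old x) && (a \notin Chg x)) (reads (qry v) (Mt x)).

(** The queries at [qpos sg i] and [qpos sg i - bw] bound a window of [bw] spine vertices containing
    the one that carries the leaf of step [i]. Varying the shift [sg] spreads the queries over the
    spine; the offset [m] keeps the subtraction from truncating. *)
Definition qpos (sg : nat) (i : 'I_m) := m + bitrev k i + sg.
Definition misread sg x :=
  [set i in S | probes_epoch x (qpos sg i) || probes_epoch x (qpos sg i - bw)].

Definition chg_graph x := [set (a, Mt x a) | a in Chg x].

Lemma chg_graph_inj x1 x2 : chg_graph x1 = chg_graph x2 ->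
  Chg x1 = Chg x2 /\ {in Chg x1, Mt x1 =1 Mt x2}.
Proof.
move=> E.
have sub x y : chg_graph x = chg_graph y -> forall a, a \in Chg x ->
    a \in Chg y /\ Mt x a = Mt y a.
  move=> {}E a ax; have : (a, Mt x a) \in chg_graph y.
    by rewrite -E; apply/imsetP; exists a.
  by case/imsetP=> b by_ [-> ->].
split; last by move=> a /(sub _ _ E)[].
by apply/setP=> a; apply/idP/idP => [/(sub _ _ E)[]|/(sub _ _ (esym E))[]].
Qed.

Lemma same_code_same_answer (x1 x2 : {set 'I_m}) v :
  x1 :\: S = x2 :\: S -> chg_graph x1 = chg_graph x2 ->
  ~~ probes_epoch x1 v -> ~~ probes_epoch x2 v ->
  (run (qry v) (Mt x1)).1.1 = (run (qry v) (Mt x2)).1.1.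
Proof.
move=> ES /chg_graph_inj[EC EM] /hasPn g1 /hasPn g2.
(* [M] is determined by the code [(x :\: S, chg_graph x)], and both queries answer as if run on
   it. *)
pose M a := if a \in Chg x1 then Mt x1 a else Ms x1 a.
rewrite (@run_agree _ _ _ (Mt x1) M); last first.
  move=> a /g1; rewrite /M; case: ifP => //= aC; rewrite andbT => aO.
  by rewrite Mt_frame ?aC.
apply/esym/run_agree => a /g2; rewrite /M -EC; case: ifP => [aC _|aC] /=.
  by rewrite EM.
by rewrite andbT => aO; rewrite Mt_frame -?EC ?aC // (Ms_prefix ES).
Qed.

Lemma qpos_lt sg i : sg < bw -> qpos sg i < 3 * m.
Proof.
move=> lsg; have := bitrev_lt k i.
have : bw <= m by rewrite leq_exp2l // leq_subr.
rewrite /qpos; lia.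
Qed.

(** Up to the initial sums [F], the two answers differ by the number of leaves cut inside the
    window. Additions on both sides avoid truncated subtraction. *)
Lemma answer_window sg x i : sg < bw ->
  (run (qry (qpos sg i - bw)) (Mt x)).1.1 + F (qpos sg i)
  = (run (qry (qpos sg i)) (Mt x)).1.1 + F (qpos sg i - bw)
    + #|[set j : 'I_m in x | [&& j < t, qpos sg i - bw < m + bitrev k j
                              & m + bitrev k j <= qpos sg i]]|.
Proof.
move=> lsg; have lv := qpos_lt i lsg.
have lv' : qpos sg i - bw < 3 * m by apply: leq_ltn_trans lv; rewrite leq_subr.
rewrite -(ans x lv) -(ans x lv').
set A := [set j in x | _ & m + _ <= qpos sg i]; set B := [set j in x | _ & m + _ <= _ - _].
rewrite -(cardsID B A).
have -> : A :&: B = B.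
  by apply/setIidPr/subsetP=> j; rewrite !inE => /and3P[-> -> /=]; lia.
set G := [set j in x | [&& _, _ & _]]; have -> : A :\: B = G.
  apply/setP=> j; rewrite !inE.
  by case: (j \in x); case: (j < t); rewrite ?andbF //= -ltnNge andbC.
by rewrite addnCA !addnA.
Qed.

(** Equal codes give equal window counts. Steps outside the epoch contribute equally, and by
    [bitrev_sep] step [i] is the only one of the epoch in the window, so the counts reveal its
    bit. *)
Lemma same_code_close sg (x1 x2 : {set 'I_m}) : sg < bw ->
  x1 :\: S = x2 :\: S -> chg_graph x1 = chg_graph x2 ->
  forall i : 'I_m, i \in S -> i \notin misread sg x1 -> i \notin misread sg x2 ->
  (i \in x1) = (i \in x2).
Proof.
move=> lsg ES EG i iS; rewrite !inE; rewrite inE in iS; rewrite iS /=.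
rewrite !negb_or => /andP[b1 b1'] /andP[b2 b2'].
have := answer_window x1 i lsg; rewrite (same_code_same_answer ES EG b1' b2').
rewrite (same_code_same_answer ES EG b1 b2) (answer_window x2 i lsg) => /eqP.
rewrite eqn_add2l => /eqP.
set P := (fun j : 'I_m => [&& j < t, qpos sg i - bw < m + bitrev k j
                              & m + bitrev k j <= qpos sg i]).
have split_S (x : {set 'I_m}) :
    #|[set j in x | P j]| = #|[set j in x :\: S | P j]| + (i \in x).
  rewrite -(cardsID S) addnC; congr addn.
    by apply: eq_card => j; rewrite !inE; case: (s <= j < c) => //=; rewrite ?andbF.
  have -> : [set j in x | P j] :&: S = if i \in x then [set i] else set0.
    have Pi : P i.
      rewrite /P /qpos; case/andP: iS => [_ lic].
      have : 0 < bw by rewrite expn_gt0.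
      have : bw <= m by rewrite leq_exp2l // leq_subr.
      move=> h1 h2; apply/and3P; split; lia.
    apply/setP=> j; rewrite !inE.
    have [->|nji] := eqVneq j i.
      by rewrite Pi iS !andbT; case: (i \in x); rewrite inE ?eqxx.
    have nPj : P j -> s <= j < c -> False.
      move=> /and3P[_ l1 l2] jS; case/eqP: nji; apply/val_inj => /=.
      apply: (bitrev_sep le_ek) => //; first by rewrite !node.
        by move: l1 l2; rewrite /qpos; lia.
      by move: l1 l2; rewrite /qpos; lia.
    have -> : (j \in (if i \in x then [set i] else set0)) = false.
      by case: ifP => _; rewrite inE // (negPf nji).
    by apply/negP => /andP[/andP[_ /nPj H] /H].
  by case: (i \in x); rewrite ?cards1 ?cards0.
by rewrite (split_S x1) (split_S x2) ES => /addnI; case: (i \in x1); case: (i \in x2).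
Qed.

Lemma card_epoch_ge : r <= #|S|.
Proof.
have lt_m (j : 'I_r) : s + j < m by have := ltn_ord j; lia.
pose f j : 'I_m := Ordinal (lt_m j).
have f_inj : injective f by move=> j1 j2 /(congr1 val) /= /addnI /val_inj.
rewrite -{1}(card_ord r) -(card_imset _ f_inj).
apply/subset_leq_card/subsetP=> _ /imsetP[j _ ->]; rewrite inE /=.
by have := ltn_ord j; lia.
Qed.

(** Inputs with the same code differ only at steps misread for one of them, at most [#|S| / 16] in
    all. So the inputs number at most the codes times the size of a Hamming ball. *)
Lemma card_decodable sg : sg < bw ->
  #|[set x | (32 * #|misread sg x| <= #|S|) && (#|Chg x| <= W)]| ^ 2
  <= 2 ^ (2 * (m - #|S|) + 2 * (2 * w + 1) * W + #|S|).
Proof.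
move=> lsg; set X := [set x | _].
pose f x := (x :\: S, chg_graph x).
pose Y := setX (powerset (~: S)) [set G : {set word w * word w} | #|G| <= W].
set V := #|[set E : {set 'I_m} | (E \subset S) && (16 * #|E| <= #|S|)]|.
have cardX : #|X| <= #|Y| * V.
  apply: (card_le_fibres (f := f)) => [x|y].
    rewrite inE => /andP[_ leW]; rewrite inE /= powersetE setDE subsetIr inE /=.
    exact: leq_trans (leq_imset_card _ _) leW.
  have [->|[x0 ]] := set_0Vmem [set x in X | f x == y]; first by rewrite cards0.
  rewrite !inE => /andP[/andP[mis0 _] /eqP <-].
  (* The symmetric difference with a fixed member [x0] embeds the fibre in the ball. *)
  pose D x := (x0 :\: x) :|: (x :\: x0).
  have D_inj : injective D.
    move=> x1 x2 /setP E; apply/setP=> i; have := E i; rewrite !inE.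
    by case: (i \in x0); case: (i \in x1); case: (i \in x2).
  rewrite -(card_imset _ D_inj); apply/subset_leq_card/subsetP=> _ /imsetP[x + ->].
  rewrite !inE => /andP[/andP[mis _] /eqP[ES EG]].
  have sDS : D x \subset S.
    apply/subsetP=> i; have /setP/(_ i) := ES; rewrite !inE.
    by case: (s <= i < c); case: (i \in x0); case: (i \in x).
  rewrite sDS /=.
  have : #|D x| <= #|misread sg x0| + #|misread sg x|.
    apply: leq_trans (leq_card_setU _ _).
    apply/subset_leq_card/subsetP=> i iD; rewrite inE; apply/negPn/negP.
    rewrite negb_or => /andP[n0 n1].
    have := same_code_close lsg (esym ES) (esym EG) (subsetP sDS i iD) n0 n1.
    by move: iD; rewrite !inE; case: (i \in x0); case: (i \in x).
  move=> leD; rewrite -(@leq_pmul2l 2) // mulnA.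
  apply: leq_trans (leq_mul (leqnn 32) leD) _.
  by rewrite mulnDr mul2n -addnn leq_add.
have cardY : #|Y| <= 2 ^ (m - #|S|) * 2 ^ ((2 * w + 1) * W).
  rewrite cardsX card_powerset cardsCs setCK card_ord leq_mul2l; apply/orP; right.
  apply: leq_trans (card_small_sets _ _) _.
  rewrite expnM leq_exp2rW // card_prod !card_ord -expnD addnn -mul2n addn1 expnS.
  have : 0 < 2 ^ (2 * w) by rewrite expn_gt0.
  by move: (2 ^ _) => q; lia.
have V2 : V ^ 2 <= 2 ^ #|S| := card_hamming_ball S.
apply: leq_trans (leq_exp2rW 2 cardX) _; rewrite expnMn expnD.
apply: leq_mul V2; apply: leq_trans (leq_exp2rW 2 cardY) _.
rewrite expnMn -!expnM -expnD leq_exp2l //; lia.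
Qed.

(** Averaging over the [bw] shifts: each query vertex serves at most once as upper end and once as
    lower end of a window, so few probing queries cause few misreads in total. *)
Lemma exists_good_shift x :
  128 * (\sum_(v < 3 * m) probes_epoch x v) <= m ->
  exists2 sg, sg < bw & 32 * #|misread sg x| <= #|S|.
Proof.
move=> few.
have mE : m = bw * 2 ^ e by rewrite -expnD subnK.
have bw_gt0 : 0 < bw by rewrite expn_gt0.
have le_bw : bw <= m by rewrite leq_exp2l // leq_subr.
have inj_pos (d : nat) : d <= m ->
    \sum_(sg < bw) \sum_(i in S) probes_epoch x (qpos sg i - d)
    <= \sum_(v < 3 * m) probes_epoch x v.
  move=> le_d; rewrite pair_big_dep /=.
  have lt3 (p : 'I_bw * 'I_m) : qpos p.1 p.2 - d < 3 * m.
    by apply: leq_ltn_trans (qpos_lt p.2 (ltn_ord p.1)); rewrite leq_subr.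
  pose g p := Ordinal (lt3 p).
  have g_inj : {in [pred p : 'I_bw * 'I_m | p.2 \in S] &, injective g}.
    move=> [g1 i1] [g2 i2]; rewrite !inE /= => S1 S2 /(congr1 val) /=.
    have l1 := ltn_ord g1; have l2 := ltn_ord g2; rewrite /qpos => E.
    have Ei : i1 = i2.
      by apply: val_inj; apply: (bitrev_sep le_ek) => /=; rewrite ?ltn_ord ?node //; lia.
    congr pair => //; apply/val_inj => /=; move: E; rewrite Ei; lia.
  rewrite (eq_bigr (fun p => nat_of_bool (probes_epoch x (g p)))) //.
  rewrite -(big_imset (fun v : 'I__ => nat_of_bool (probes_epoch x v))) //=.
  by rewrite [leqRHS](bigID [in g @: [pred p | p.2 \in S]]) /= leq_addr.
have tot : \sum_(sg < bw) #|misread sg x| <=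
    2 * \sum_(v < 3 * m) probes_epoch x v.
  rewrite mul2n -addnn.
  apply: leq_trans (leq_add (inj_pos 0 isT) (inj_pos bw le_bw)).
  rewrite -big_split /=; apply: leq_sum => sg _; rewrite -big_split /=.
  rewrite -sum1_card big_mkcond [leqRHS]big_mkcond /=; apply: leq_sum => i _.
  rewrite !inE subn0; case: (s <= i < c) => //=.
  by case: (probes_epoch x (qpos sg i)); case: (probes_epoch _ _).
have [/existsP[sg H]|/existsPn all_big] :=
    boolP [exists sg : 'I_bw, 32 * #|misread sg x| <= #|S|].
  by exists sg.
(* Otherwise the total exceeds [bw * #|S| / 32], which is at least [m / 64], against [few] and
   [tot]. *)
have : \sum_(sg < bw) #|S|.+1 <= \sum_(sg < bw) 32 * #|misread sg x|.
  by apply: leq_sum => sg _; rewrite ltnNge all_big.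
rewrite sum_nat_const card_ord -big_distrr /= => H.
have le_r : 2 ^ e <= 2 * #|S| by have := card_epoch_ge; lia.
have : m <= bw * (2 * #|S|) by rewrite {1}mE leq_mul2l le_r orbT.
move: H tot few; rewrite mulnS mulnCA.
move: (\sum_(sg < bw) _) (\sum_(v < 3 * m) _) (bw * #|S|) => T1 T2 q.
lia.
Qed.

(** A union bound over the [bw] shifts; the term [2 * k + 2] of the hypothesis pays for the square
    of the factor [2 * bw]. *)
Lemma epoch_core : 2 * k + 2 * (2 * w + 1) * W + 2 <= r ->
  2 * #|[set x | (128 * (\sum_(v < 3 * m) probes_epoch x v) <= m)
                 && (#|Chg x| <= W)]| <= 2 ^ m.
Proof.
move=> big_r; set X := [set x | _].
pose Y (sg : 'I_bw) := [set x | (32 * #|misread sg x| <= #|S|) && (#|Chg x| <= W)].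
have le_S : #|S| <= m by rewrite -[leqRHS]card_ord max_card.
have le_rS := card_epoch_ge.
have cardY sg : 2 * bw * #|Y sg| <= 2 ^ m.
  rewrite -(@leq_exp2r _ _ 2) // expnMn.
  apply: leq_trans (leq_mul (leqnn _) (card_decodable (ltn_ord sg))) _.
  rewrite -expnS -!expnM -expnD leq_exp2l //; nia.
have cardX : #|X| <= \sum_sg #|Y sg|.
  apply: (@leq_trans #|\bigcup_sg Y sg|).
    apply/subset_leq_card/subsetP=> x; rewrite inE => /andP[/exists_good_shift].
    case=> sg lsg H leW; apply/bigcupP; exists (Ordinal lsg) => //.
    by rewrite inE H leW.
  elim/big_ind2: _ => [|A a B b lA lB|//]; first by rewrite cards0.
  by apply: leq_trans (leq_card_setU _ _) (leq_add lA lB).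
have : 2 * bw * #|X| <= bw * 2 ^ m.
  apply: leq_trans (leq_mul (leqnn _) cardX) _; rewrite big_distrr /=.
  rewrite -[X in _ <= X * _]card_ord -sum_nat_const; exact: leq_sum.
by rewrite mulnAC mulnC leq_pmul2l // expn_gt0.
Qed.
End Epoch.

(** * Executing sequences of operations *)

Section Execution.
Variables (n w : nat) (D : DS n w).
Implicit Types (M : memory w) (p : parent_fn n) (l : seq (op n)).

Definition op_mem M (o : op n) : memory w :=
  match o with
  | Cut v => (run (ds_cut D v) M).1.2
  | SubtreeSum v => (run (ds_sum D v) M).1.2
  end.

Definition op_cost M (o : op n) : nat :=
  match o with
  | Cut v => (run (ds_cut D v) M).2
  | SubtreeSum v => (run (ds_sum D v) M).2
  end.

Definition mem_after M l := foldl op_mem M l.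

Fixpoint cost_after M l : nat :=
  if l is o :: l' then op_cost M o + cost_after (op_mem M o) l' else 0.

Definition forest_after p l :=
  foldl (fun p o => if o is Cut v then cut_forest p v else p) p l.

Lemma exec_cost M p l : (exec D M p l).2 = cost_after M l.
Proof.
elim: l M p => //= -[v|v] l IH M p /=.
- case: (run _ _) => [[a M'] c] /=.
  by rewrite -(IH M' (cut_forest p v)); case: (exec _ _ _ _).
- case: (run _ _) => [[a M'] c] /=.
  by rewrite -(IH M' p); case: (exec _ _ _ _).
Qed.

Lemma exec_cat_ok M p l1 l2 : (exec D M p (l1 ++ l2)).1 ->
  (exec D (mem_after M l1) (forest_after p l1) l2).1.
Proof.
elim: l1 M p => //= -[v|v] l1 IH M p /=.
- case: (run _ _) => [[a M'] c] /=.
  by have := IH M' (cut_forest p v); case: (exec _ _ _ (l1 ++ l2)).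
- case: (run _ _) => [[a M'] c] /=.
  have := IH M' p; case: (exec _ _ _ (l1 ++ l2)) => ok c' /= H.
  by case/andP.
Qed.

Lemma cost_after_cat M l1 l2 :
  cost_after M (l1 ++ l2) = cost_after M l1 + cost_after (mem_after M l1) l2.
Proof. by elim: l1 M => //= o l IH M; rewrite IH addnA. Qed.

Lemma mem_after_cat M l1 l2 :
  mem_after M (l1 ++ l2) = mem_after (mem_after M l1) l2.
Proof. by rewrite /mem_after foldl_cat. Qed.

Lemma forest_after_cat p l1 l2 :
  forest_after p (l1 ++ l2) = forest_after (forest_after p l1) l2.
Proof. by rewrite /forest_after foldl_cat. Qed.

Lemma legal_cat p l1 l2 :
  legal p l1 -> legal (forest_after p l1) l2 -> legal p (l1 ++ l2).
Proof.
elim: l1 p => //= -[v|v] l1 IH p /=.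
- by case=> pv L1 L2; split=> //; apply: IH.
- exact: IH.
Qed.

Lemma legal_queries p (q : seq 'I_n) : legal p [seq SubtreeSum v | v <- q].
Proof. by elim: q. Qed.

Lemma card_mem_changed M l :
  #|[set a | mem_after M l a != M a]| <= cost_after M l.
Proof.
elim: l M => [|o l IH] M /=.
  by rewrite leqn0 cards_eq0; apply/eqP/setP=> a; rewrite !inE eqxx.
have le_op : #|[set a | op_mem M o a != M a]| <= op_cost M o.
  by case: o => v; apply: card_run_changed.
apply: leq_trans (leq_add le_op (IH (op_mem M o))).
apply: leq_trans (leq_card_setU _ _).
apply/subset_leq_card/subsetP=> a; rewrite !inE.
by have [->|] := eqVneq (op_mem M o a) (M a).
Qed.

(** Correctness concerns whole sequences, so the query is appended to [l]. *)
Lemma correct_answer p l v : correct D -> is_forest p -> legal p l ->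
  (run (ds_sum D v) (mem_after (ds_init D p) l)).1.1
  = subtree_sum (forest_after p l) v.
Proof.
move=> Dok pF pl.
have := Dok p pF (l ++ [:: SubtreeSum v]).
move=> /(_ (legal_cat pl _)) => /(_ I) /exec_cat_ok /=.
by case: (run _ _) => [[a M'] c] /=; rewrite andbT => /eqP.
Qed.

End Execution.

(** * Subtree sums after cutting leaves; the caterpillar *)

Lemma in_subtree_cut_leaves n (p0 p : parent_fn n) (Z : {set 'I_n}) (v u : 'I_n) :
  (forall a, p a = if a \in Z then None else p0 a) ->
  (forall a z, z \in Z -> p0 a <> Some z) -> v \notin Z ->
  in_subtree p v u = in_subtree p0 v u && (u \notin Z).
Proof.
move=> pE leafZ vZ; have iterN q j : iter j (up q) None = None :> option 'I_n.
  by elim: j => //= j ->.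
have [uZ|uZ] := boolP (u \in Z); rewrite ?andbT ?andbF /=.
  apply/existsP=> -[[[|j] lj] /eqP /=].
    by case=> E; rewrite E (negPf vZ) in uZ.
  by rewrite -iterS iterSr /= pE uZ iterN.
suff E j : iter j (up p) (Some u) = iter j (up p0) (Some u).
  by apply: eq_existsb => j; rewrite E.
(* As no vertex has its parent in [Z], a climb that starts outside [Z] never enters it. *)
suff : iter j (up p) (Some u) = iter j (up p0) (Some u) /\
    forall z, iter j (up p0) (Some u) = Some z -> z \notin Z by case.
elim: j => [|j [IH1 IH2]] /=; first by split=> // z [<-].
rewrite IH1; case E: (iter j (up p0) (Some u)) => [a|] //=.
rewrite pE (negPf (IH2 _ E)); split=> // z Ez; apply/negP=> zZ.
exact: (leafZ a z zZ).
Qed.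

Lemma subtree_sum_cut_leaves n (p0 p : parent_fn n) (Z : {set 'I_n}) (v : 'I_n) :
  (forall a, p a = if a \in Z then None else p0 a) ->
  (forall a z, z \in Z -> p0 a <> Some z) -> v \notin Z ->
  subtree_sum p v + #|[set u in Z | in_subtree p0 v u]| = subtree_sum p0 v.
Proof.
move=> pE leafZ vZ; rewrite [RHS]/subtree_sum.
rewrite -(cardsID Z [set u | in_subtree p0 v u]) [RHS]addnC; congr addn.
  apply: eq_card => u; rewrite !inE (in_subtree_cut_leaves _ pE) //.
  by rewrite andbC.
by apply: eq_card => u; rewrite !inE andbC.
Qed.

Section Caterpillar.
(* Spine [0 -> 1 -> ... -> 3m-1], with the leaf [3m + y] hanging from the spine vertex [m + y] for [y < m]; the remaining vertices are isolated. *)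
Variables (n m : nat) (v0 : 'I_n).
Hypotheses (m_gt0 : 0 < m) (le_mn : 4 * m <= n).

Definition vtx (j : nat) : 'I_n := insubd v0 j.

Lemma val_vtx j : j < n -> vtx j = j :> nat.
Proof. by move=> lj; rewrite val_insubd lj. Qed.

Definition caterpillar : parent_fn n := fun u =>
  if u < 3 * m then if u.+1 < 3 * m then Some (vtx u.+1) else None
  else if u < 4 * m then Some (vtx (u - 2 * m)) else None.

Lemma caterpillar_spine a j : a < 3 * m ->
  iter j (up caterpillar) (Some (vtx a))
  = if a + j < 3 * m then Some (vtx (a + j)) else None.
Proof.
move=> la; elim: j => [|j IH]; first by rewrite addn0 la.
rewrite iterS {}IH addnS; case: ltnP => lj; last by case: ltnP => //; lia.
by rewrite /= /caterpillar val_vtx ?lj //; lia.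
Qed.

Lemma caterpillar_leaf y j : y < m ->
  iter j.+1 (up caterpillar) (Some (vtx (3 * m + y)))
  = if m + y + j < 3 * m then Some (vtx (m + y + j)) else None.
Proof.
move=> ly; rewrite iterSr /= /caterpillar val_vtx; last by lia.
have -> : (3 * m + y < 3 * m) = false by lia.
have -> : 3 * m + y < 4 * m by lia.
have -> : 3 * m + y - 2 * m = m + y by lia.
by rewrite caterpillar_spine //; lia.
Qed.

Lemma caterpillar_forest : is_forest caterpillar.
Proof.
move=> u; have -> : u = vtx u by apply/val_inj; rewrite /= val_vtx.
have [lu|lu] := ltnP u (3 * m).
  by rewrite caterpillar_spine // ifF //; lia.
have nE : n = n.-1.+1 by lia.
rewrite [X in iter X]nE.
have [lu'|lu'] := ltnP u (4 * m).
  have -> : nat_of_ord u = 3 * m + (u - 3 * m) by lia.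
  by rewrite caterpillar_leaf ?ifF //; lia.
rewrite iterSr /= /caterpillar val_vtx // !ifF; try lia.
by elim: n.-1 => //= j ->.
Qed.

Lemma caterpillar_no_child a y : y < m -> caterpillar a <> Some (vtx (3 * m + y)).
Proof.
move=> ly; rewrite /caterpillar.
case: ltnP => la; [case: ltnP => la' //|case: ltnP => la' //] => -[] /(congr1 val).
  by rewrite /= !val_vtx; lia.
by rewrite /= !val_vtx; lia.
Qed.

Lemma caterpillar_subtree_leaf v y : v < 3 * m -> y < m ->
  in_subtree caterpillar (vtx v) (vtx (3 * m + y)) = (m + y <= v).
Proof.
move=> lv ly; apply/existsP/idP => [[[[|j] lj] /eqP]|le_yv].
- by case=> /(congr1 val); rewrite /= !val_vtx; lia.
- rewrite [nat_of_ord _]/= caterpillar_leaf //.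
  by case: ltnP => // lt3 [] /(congr1 val); rewrite /= !val_vtx; lia.
- have lj : (v - (m + y)).+1 < n.+1 by lia.
  exists (Ordinal lj); rewrite [nat_of_ord _]/= caterpillar_leaf // subnKC //.
  by rewrite lv.
Qed.

End Caterpillar.

(** In each aligned block of length [2 * h], adding [h] injects the lower half into the upper
    half. *)
Lemma upper_half_count m h : 0 < h -> 2 * h %| m ->
  m <= 2 * \sum_(t < m) (h <= t %% (2 * h)).
Proof.
move=> h_gt0 /dvdnP[q Eq]; set N := 2 * h in Eq *.
have N_gt0 : 0 < N by rewrite muln_gt0.
pose lo := [set t : 'I_m | t %% N < h].
pose f (t : 'I_m) : 'I_m := insubd t (t + h).
have f_val (t : 'I_m) : t \in lo -> f t = t + h :> nat.
  rewrite inE => lt; rewrite val_insubd ifT //.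
  have ltq : t %/ N < q by rewrite ltn_divLR // -Eq.
  have leN : (t %/ N).+1 * N <= m by rewrite [X in _ <= X]Eq leq_mul2r ltq orbT.
  apply: leq_trans leN; rewrite {1}(divn_eq t N) mulSn -addnA.
  rewrite [leqRHS]addnC -addnS leq_add2l {2}/N mul2n -addnn -addSn.
  by rewrite leq_add2r.
have f_inj : {in lo &, injective f}.
  by move=> t1 t2 l1 l2 /(congr1 val); rewrite /= !f_val // => /addIn /val_inj.
have le_lo : #|lo| <= #|~: lo|.
  rewrite -(card_in_imset f_inj); apply/subset_leq_card/subsetP=> _ /imsetP[t tl ->].
  rewrite !inE f_val // -leqNgt; move: tl; rewrite inE => tl.
  by rewrite -modnDml modn_small ?leq_addl // {2}/N mul2n -addnn ltn_add2r.
have -> : \sum_(t < m) (h <= t %% N) = #|~: lo|.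
  rewrite -sum1_card [RHS]big_mkcond; apply: eq_bigr => t _.
  by rewrite !inE -leqNgt; case: (h <= _).
by rewrite -{1}(card_ord m) -(cardsC lo) mul2n -addnn leq_add2r.
Qed.

(** * The adversary and its inequality for one epoch *)

Section Adversary.
Variables (n w k : nat) (D : DS n w) (v0 : 'I_n).
Notation m := (2 ^ k).
Hypothesis le_mn : 4 * m <= n.
Hypothesis D_correct : correct D.
Implicit Types (x : {set 'I_m}) (t : nat).

Let m_gt0 : 0 < m. Proof. by rewrite expn_gt0. Qed.
Notation p0 := (caterpillar m v0).
Notation M0 := (ds_init D p0).
Notation vtx := (vtx v0).

(** Membership extended by false to all natural times, since [ops] recurses on a natural number. *)
Definition bit x t := [exists j : 'I_m, (j == t :> nat) && (j \in x)].

Lemma bit_ord x (j : 'I_m) : bit x j = (j \in x).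
Proof.
apply/existsP/idP => [[i /andP[/eqP/val_inj ->]]|jx] //.
by exists j; rewrite eqxx.
Qed.

Definition leaf t := vtx (3 * m + bitrev k t).

Lemma val_leaf t : leaf t = 3 * m + bitrev k t :> nat.
Proof. by rewrite val_vtx //; have := bitrev_lt k t; lia. Qed.

(** The choice depends on the memory alone, so the operations before time [t] are determined by the
    bits of [x] before [t]. *)
Definition worst M : 'I_n := [arg max_(v > v0) (run (ds_sum D v) M).2].

Definition step x t M : seq (op n) :=
  SubtreeSum (worst M) :: if bit x t then [:: Cut (leaf t)] else [::].

Fixpoint ops x t : seq (op n) :=
  if t is t'.+1 then ops x t' ++ step x t' (mem_after D M0 (ops x t')) else [::].

Definition Mem x t := mem_after D M0 (ops x t).

Definition step_cost x t := cost_after D (Mem x t) (step x t (Mem x t)).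

Lemma cost_ops x t : cost_after D M0 (ops x t) = \sum_(j < t) step_cost x j.
Proof.
elim: t => [|t IH]; first by rewrite big_ord0.
by rewrite big_ord_recr /= cost_after_cat IH.
Qed.

Lemma size_ops x t : size (ops x t) <= 2 * t.
Proof.
elim: t => // t IH /=; rewrite size_cat /=.
by case: (bit x t) => /=; lia.
Qed.

Lemma query_le_step_cost x t v : (run (ds_sum D v) (Mem x t)).2 <= step_cost x t.
Proof.
apply: (@leq_trans (run (ds_sum D (worst (Mem x t))) (Mem x t)).2).
  by rewrite /worst; case: arg_maxnP => // u _; apply.
by rewrite /step_cost /= leq_addr.
Qed.

Lemma ops_prefix x1 x2 t : (forall j, j < t -> bit x1 j = bit x2 j) ->
  ops x1 t = ops x2 t.
Proof.
elim: t => //= t IH E; rewrite IH; last by move=> j lj; apply: E; rewrite ltnW.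
by rewrite /step E.
Qed.

Definition cut_leaves x t := [set leaf (nat_of_ord j) | j in [set j : 'I_m in x | j < t]].

Lemma leaf_inj t1 t2 : t1 < m -> t2 < m -> leaf t1 = leaf t2 -> t1 = t2.
Proof.
move=> l1 l2 /(congr1 val) /=; rewrite !val_leaf => /addnI.
exact: bitrev_inj.
Qed.

Lemma forest_ops x t : t <= m ->
  forall u, forest_after p0 (ops x t) u = if u \in cut_leaves x t then None else p0 u.
Proof.
elim: t => [|t IH] lt u /=.
  rewrite ifF //; apply/negP => /imsetP[j]; rewrite inE ltn0 andbF //.
have {}IH := IH (ltnW lt).
rewrite forest_after_cat; move: (forest_after p0 (ops x t)) IH => q IH /=.
pose jt : 'I_m := Ordinal lt.
have step_in : (u \in cut_leaves x t.+1) =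
    ((u == leaf t) && bit x t) || (u \in cut_leaves x t).
  apply/imsetP/orP => [[j]|[/andP[/eqP -> ]|/imsetP[j]]].
  - rewrite inE ltnS leq_eqVlt => /andP[jx /orP[/eqP Ej|ltj]] ->.
      by left; rewrite Ej eqxx -Ej bit_ord.
    by right; apply/imsetP; exists j; rewrite // inE jx.
  - rewrite -[t]/(val jt) bit_ord => jx; exists jt => //.
    by rewrite inE jx /= ltnS.
  - by rewrite inE => /andP[jx lj] ->; exists j; rewrite // inE jx ltnS ltnW.
rewrite step_in; case: (bit x t) => /=; last by rewrite andbF IH.
by rewrite andbT /cut_forest; case: eqP => //=; rewrite IH.
Qed.

Lemma legal_ops x t : t <= m -> legal p0 (ops x t).
Proof.
elim: t => //= t IH lt; apply: legal_cat; first exact/IH/ltnW.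
rewrite /step /=; case Eb: (bit x t) => //=; split=> //.
rewrite (forest_ops x (ltnW lt)) ifF.
  rewrite /caterpillar val_leaf.
  have -> : (3 * m + bitrev k t < 3 * m) = false by lia.
  by rewrite ifT //; have := bitrev_lt k t; lia.
apply/negP => /imsetP[j]; rewrite inE => /andP[_ lj] /leaf_inj E.
by move: lj; rewrite -E // ltnn.
Qed.

Lemma answer_ops x t v : t <= m -> v < 3 * m ->
  (run (ds_sum D (vtx v)) (Mem x t)).1.1
   + #|[set i : 'I_m in x | (i < t) && (m + bitrev k i <= v)]|
  = subtree_sum p0 (vtx v).
Proof.
move=> lt lv.
rewrite correct_answer //; [|exact: caterpillar_forest|exact: legal_ops].
rewrite -(subtree_sum_cut_leaves (forest_ops x lt)).
- congr addn.
  have linj : {in [set i : 'I_m in x | (i < t) && (m + bitrev k i <= v)] &,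
      injective (fun i : 'I_m => leaf i)}.
    by move=> i j _ _ /leaf_inj E; apply/val_inj/E.
  rewrite -(card_in_imset linj); apply: eq_card => u.
  rewrite [RHS]inE; apply/imsetP/andP => [[i]|[/imsetP[i]]].
    rewrite !inE => /and3P[ix it im] ->; split.
      by apply/imsetP; exists i; rewrite // inE ix.
    by rewrite /leaf caterpillar_subtree_leaf // bitrev_lt.
  rewrite inE => /andP[ix it] ->; rewrite /leaf caterpillar_subtree_leaf ?bitrev_lt //.
  by move=> im; exists i => //; rewrite !inE ix it.
- move=> a _ /imsetP[j _ ->]; apply: caterpillar_no_child => //.
  exact: bitrev_lt.
- apply/imsetP => -[j _ /(congr1 val)] /=; rewrite val_leaf val_vtx; lia.
Qed.

(** A cell counts even if a later step restores its content; this makes the set monotone in the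
    interval, which separates the levels. *)
Definition changed x lo hi :=
  [set a | has (fun j => Mem x j.+1 a != Mem x j a) (index_iota lo hi)].

Lemma mem_unchanged x lo hi a :
  lo <= hi -> a \notin changed x lo hi -> Mem x hi a = Mem x lo a.
Proof.
move=> le_lohi; rewrite inE => /hasPn same.
have H d : lo + d <= hi -> Mem x (lo + d) a = Mem x lo a.
  elim: d => [|d IH] ld; first by rewrite addn0.
  rewrite addnS -IH; last by lia.
  apply/eqP; have := same (lo + d); rewrite mem_index_iota negbK; apply; lia.
by have := H (hi - lo); rewrite subnKC // => ->.
Qed.

Lemma changed_sub x lo1 hi1 lo2 hi2 a : lo2 <= lo1 -> hi1 <= hi2 ->
  a \in changed x lo1 hi1 -> a \in changed x lo2 hi2.
Proof.
move=> llo lhi; rewrite !inE => /hasP[j]; rewrite mem_index_iota => /andP[l1 l2] H.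
apply/hasP; exists j => //; rewrite mem_index_iota; lia.
Qed.

Lemma card_changed x lo hi : #|changed x lo hi| <= \sum_(lo <= j < hi) step_cost x j.
Proof.
have le_step j : #|[set a | Mem x j.+1 a != Mem x j a]| <= step_cost x j.
  by rewrite /Mem /= mem_after_cat; apply: card_mem_changed.
apply: leq_trans (leq_sum _ (fun j _ => le_step j)).
rewrite /changed; elim: (index_iota lo hi) => [|j l IH] /=.
  rewrite big_nil leqn0 cards_eq0; apply/eqP/setP => a; by rewrite !inE.
rewrite big_cons; apply: leq_trans (leq_add (leqnn _) IH).
apply: leq_trans (leq_card_setU _ _).
by apply/subset_leq_card/subsetP => a; rewrite !inE.
Qed.

Definition hits (s c t : nat) x v :=
  probes_epoch (Mem^~ t) (fun x => changed x c t) (fun x => changed x s c)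
    (fun v => ds_sum D (vtx v)) x v.

(** At most half of the inputs lie in [G]. For any other, more than [m / 128] query vertices hit the
    epoch or more than [W] cells changed in [[c, t)]; either alternative alone accounts for
    [m * W]. *)
Lemma epoch_inequality e s c t W :
  e <= k -> (forall i, s <= i < c -> i %/ 2 ^ e = s %/ 2 ^ e) ->
  s <= c -> c <= t -> t <= m -> 2 ^ e <= 2 * (c - s) ->
  2 * k + 2 * (2 * w + 1) * W + 2 <= c - s ->
  m * W * 2 ^ m <= 256 * W * (\sum_x \sum_(v < 3 * m) hits s c t x v)
    + 2 * m * \sum_x \sum_(c <= j < t) step_cost x j.
Proof.
move=> lek node lsc lct ltm rbig Wsmall.
pose H x := \sum_(v < 3 * m) hits s c t x v.
pose G := [set x | (128 * H x <= m) && (#|changed x c t| <= W)].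
have cardG : 2 * #|G| <= 2 ^ m.
  apply: (@epoch_core w k e s c t W (Mem^~ s) (Mem^~ t) (fun x => changed x c t)
    (fun x => changed x s c) _ (fun v => subtree_sum p0 (vtx v))) => //.
  - exact: leq_trans ltm.
  - move=> x1 x2 E a; rewrite /Mem; congr (mem_after _ _ _ a).
    apply: ops_prefix => j lj.
    have ljm : j < m by lia.
    rewrite -[j]/(val (Ordinal ljm)) !bit_ord.
    have /setP/(_ (Ordinal ljm)) := E; rewrite !inE /=.
    by have -> : (s <= j < c) = false by lia.
  - move=> x a nC nO; rewrite (mem_unchanged lct nC); exact: mem_unchanged.
  - by move=> x v; apply: answer_ops.
have notG x : x \notin G ->
    m * W <= 128 * W * H x + m * \sum_(c <= j < t) step_cost x j.
  rewrite inE negb_and -!ltnNge => /orP[big|big].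
    apply: leq_trans (leq_addr _ _); rewrite mulnAC leq_mul2r ltnW ?orbT //.
  apply: leq_trans (leq_addl _ _); rewrite leq_mul2l orbC ltnW //.
  exact: leq_trans big (card_changed _ _ _).
have : \sum_(x | x \notin G) m * W
    <= \sum_x (128 * W * H x + m * \sum_(c <= j < t) step_cost x j).
  rewrite [leqRHS](bigID [in G]) /=; apply: leq_trans (leq_addl _ _).
  exact: leq_sum.
rewrite sum_nat_const big_split /= -!big_distrr /= -/(H _).
have -> : #|[pred x | x \notin G]| = #|~: G|.
  by apply: eq_card => x; rewrite !inE.
have : #|G| + #|~: G| = 2 ^ m.
  by rewrite cardsC -cardsT -powersetT card_powerset cardsT card_ord.

set S1 := \sum_x H x; set S2 := \sum_x \sum_(c <= j < t) step_cost x j.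
move: cardG; move: #|G| #|~: G| S1 S2 (2 ^ m) => g g' S1 S2 q Hg Hq.
have lq : q <= 2 * g' by lia.
move=> H1; apply: (@leq_trans (2 * (g' * (m * W)))); last by lia.
by rewrite mulnA mulnC leq_mul2r lq orbT.
Qed.

(** * Levels of the chronogram *)

Section Levels.
Variables (be L lam : nat).
Hypotheses (be_gt0 : 0 < be) (lam_gt0 : 0 < lam) (leL : be * L <= k) (leLlam : L <= lam).
Hypothesis be_big : 2 * (2 * k + 2 * (2 * w + 1) * lam + 2) <= 2 ^ be.

Notation width i := (2 ^ (be * i)).
Definition node_start i t := t %/ width i * width i.
Definition level_hit i t x v := hits (node_start i.+1 t) (node_start i t) t x v.

Lemma node_start_le i t : node_start i t <= t.
Proof. exact: leq_divM. Qed.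

Lemma node_start_anti i j t : i <= j -> node_start j t <= node_start i t.
Proof.
move=> leij; rewrite /node_start.
have -> : width j = width i * width (j - i) by rewrite -expnD -mulnDr subnKC.
by rewrite divnMA (mulnC (width i)) mulnA leq_mul2r leq_divM orbT.
Qed.

(** For [i < j] the epoch of level [i] lies in the period whose changes level [j] excludes, so each
    read counts for at most one level. *)
Lemma sum_level_hit t x v :
  \sum_(i < L) level_hit i t x v <= (run (ds_sum D (vtx v)) (Mem x t)).2.
Proof.
apply: leq_trans (size_reads _ _).
rewrite /level_hit /hits /probes_epoch -sum1_size.
set P := fun i a => (a \in changed x (node_start i.+1 t) (node_start i t))
  && (a \notin changed x (node_start i t) t).
set l := reads _ _.
apply: (@leq_trans (\sum_(i < L) \sum_(a <- l) P i a)).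
  by apply: leq_sum => i _; rewrite -big_mkcond /= sum1_count has_count; case: (count _ _).
rewrite exchange_big /=; apply: leq_sum => a _.
have excl i j : i < j -> P i a -> P j a -> False.
  move=> ltij /andP[ci _] /andP[_ /negP[]].
  apply: changed_sub ci; first exact: node_start_anti.
  exact: node_start_le.
have [/existsP[i Pi]|/existsPn none] := boolP [exists i : 'I_L, P i a].
  rewrite (bigD1 i) //= Pi big1 // => j nij; apply/eqP; rewrite eqb0; apply/negP=> Pj.
  by case: (ltngtP i j) => [/excl|/excl|/val_inj E]; [apply|apply|rewrite E eqxx in nij].
by rewrite big1 // => i _; apply/eqP; rewrite eqb0.
Qed.

Definition late i t := width i.+1 <= 2 * (node_start i t - node_start i.+1 t).

(** Times in the upper half of an interval of length [width i.+1] are late: [width i] divides the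
    half length, so [node_start i t] does not fall below the midpoint. *)
Lemma half_late i : i < L -> m <= 2 * \sum_(t < m) late i t.
Proof.
move=> ltiL; set N := width i.+1.
have leek : be * i.+1 <= k by apply: leq_trans leL; rewrite leq_mul2l ltiL orbT.
pose h := 2 ^ (be * i.+1).-1.
have N2 : N = 2 * h by rewrite /N /h -expnS prednK // muln_gt0 be_gt0.
have h_gt0 : 0 < h by rewrite expn_gt0.
have N_m : N %| m by rewrite dvdn_exp2l.
have b_h : width i %| h.
  by rewrite dvdn_exp2l // mulnS; lia.
have late_hi t : h <= t %% N -> late i t.
  move=> hi; rewrite /late -/N N2 leq_mul2l /=.
  rewrite leq_subRL ?node_start_anti // /node_start -/N.
  have /dvdnP[q Eq] : width i %| t %/ N * N + h.
    rewrite dvdn_add //; apply: dvdn_mull; rewrite dvdn_exp2l // leq_mul2l.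
    by rewrite leqnSn orbT.
  rewrite Eq leq_mul2r leq_divRL ?expn_gt0 //; apply/orP; right.
  by rewrite -Eq {2}(divn_eq t N) leq_add2l.
apply: leq_trans (upper_half_count h_gt0 _) _; first by rewrite -N2.
rewrite leq_mul2l -N2 /=; apply: leq_sum => t _.
by case: (leqP h) => // /late_hi ->.
Qed.

Lemma card_same_quotient b q : 0 < b -> \sum_(t < m) (t %/ b == q) <= b.
Proof.
move=> b_gt0; rewrite -big_mkcond /= sum1dep_card.
pose f (t : 'I_m) : 'I_b := Ordinal (ltn_pmod t b_gt0).
rewrite -[leqRHS]card_ord -(@card_in_imset _ _ f) ?max_card // => t1 t2.
rewrite !inE => /eqP q1 /eqP q2 /(congr1 val) /= E; apply/val_inj => /=.
by rewrite (divn_eq t1 b) (divn_eq t2 b) q1 q2 E.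
Qed.

Notation total x := (\sum_(j < m) step_cost x j).

(** Step [j] is charged only by times [t] in its own interval of length [width i]. *)
Lemma sum_child_cost i x :
  \sum_(t < m) \sum_(node_start i t <= j < t) step_cost x j <= width i * total x.
Proof.
have b_gt0 : 0 < width i by rewrite expn_gt0.
apply: (@leq_trans (\sum_(t < m) \sum_(j < m) (t %/ width i == j %/ width i) * step_cost x j)).
  apply: leq_sum => t _.
  rewrite (@big_nat_widenl _ _ _ _ 0) // (@big_nat_widen _ _ _ _ _ m) ?(ltnW (ltn_ord t)) //.
  rewrite big_mkord big_mkcond /=; apply: leq_sum => j _.
  case: ifP => // /andP[l1 l2].
  rewrite [X in nat_of_bool X](_ : _ = true) ?mul1n //.
  by rewrite eqn_leq leq_divRL // l1 leq_div2r // ltnW.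
rewrite exchange_big /= big_distrr /=; apply: leq_sum => j _.
rewrite -big_distrl /= leq_mul2r card_same_quotient ?orbT //.
Qed.

(** Summation of [epoch_inequality] over the late times with [W = lam * width i]; the factor
    [width i] cancels by [sum_child_cost]. *)
Lemma level_inequality i : i < L ->
  m * m * lam * 2 ^ m <=
  512 * lam * (\sum_(t < m) \sum_x \sum_(v < 3 * m) level_hit i t x v)
  + 4 * m * \sum_x total x.
Proof.
move=> ltiL; set b := width i.
have b_gt0 : 0 < b by rewrite expn_gt0.
have leek : be * i.+1 <= k by apply: leq_trans leL; rewrite leq_mul2l ltiL orbT.
have NE : width i.+1 = 2 ^ be * b by rewrite mulnS expnD.
have per_t (t : 'I_m) : late i t * (m * (lam * b) * 2 ^ m) <=
    256 * (lam * b) * (\sum_x \sum_(v < 3 * m) level_hit i t x v)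
    + 2 * m * \sum_x \sum_(node_start i t <= j < t) step_cost x j.
  case lt: (late i t) => //; rewrite mul1n.
  apply: (epoch_inequality leek) => //.
  - move=> j /andP[lj hj].
    have E : node_start i.+1 t %/ width i.+1 = t %/ width i.+1.
      by rewrite mulnK // expn_gt0.
    rewrite E; apply/eqP; rewrite eqn_leq; apply/andP; split; last by rewrite -E leq_div2r.
    by apply: leq_div2r; apply: leq_trans (ltnW hj) (node_start_le _ _).
  - exact: node_start_anti.
  - exact: node_start_le.
  - exact/ltnW/ltn_ord.
  - move: lt; rewrite /late NE => lt; rewrite -(@leq_pmul2l 2) //.
    apply: leq_trans lt; apply: leq_trans (leq_mul be_big (leqnn b)).
    rewrite -[leqRHS]mulnA leq_mul2l /= [leqRHS]mulnDl [_ * b in leqRHS]mulnDl.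
    rewrite [_ * (lam * b)]mulnA.
    by rewrite !leq_add ?leq_pmulr.
have := @leq_sum _ (index_enum 'I_m) xpredT _ _ (fun (i : 'I_m) _ => per_t i).
rewrite -big_distrl /= big_split /= -!big_distrr /=.
rewrite [X in 2 * m * X]exchange_big /=.
set H := \sum_(t < m) \sum_x _.
have lc : \sum_x \sum_(t < m) \sum_(node_start i t <= j < t) step_cost x j
    <= b * \sum_x total x.
  by rewrite big_distrr; apply: leq_sum => x _; apply: sum_child_cost.
move=> H1; have {lc H1}H2 := leq_trans H1 (leq_add (leqnn _) (leq_mul (leqnn (2 * m)) lc)).
have lh := half_late ltiL.
rewrite -(leq_pmul2l b_gt0).
(* The factor 2 makes up for only half of the times being guaranteed late. *)
apply: leq_trans (_ : 2 * ((\sum_(t < m) late i t) * (m * (lam * b) * 2 ^ m)) <= _).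
  move: (\sum_(t < m) late i t) lh (2 ^ m) => q lh Q.
  rewrite [leqRHS]mulnA; apply: leq_trans (leq_mul lh (leqnn _)).
  by rewrite leq_eqVlt; apply/orP; left; apply/eqP; lia.
move: H2; move: (\sum_x total x) H (_ * (m * _ * _)) => T1 H A; lia.
Qed.

(** Over all levels and query vertices, the hits at one time are at most [3 * m] times the step
    cost. The constant is [512 * 3 + 4], where [L <= lam] absorbs the second term. *)
Lemma sum_total_ge : L * m * 2 ^ m <= 1540 * \sum_x total x.
Proof.
have := @leq_sum _ (index_enum 'I_L) xpredT _ _ (fun i _ => level_inequality (ltn_ord i)).
rewrite sum_nat_const card_ord big_split /= -big_distrr /= sum_nat_const card_ord.
have : \sum_(i < L) \sum_(t < m) \sum_x \sum_(v < 3 * m) level_hit i t x v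
    <= 3 * m * \sum_x total x.
  rewrite exchange_big /= [X in _ <= _ * X]exchange_big /= big_distrr /=.
  apply: leq_sum => t _; rewrite exchange_big /= big_distrr /=.
  apply: leq_sum => x _; rewrite exchange_big /= -[X in _ <= X * _](card_ord (3 * m)).
  rewrite -sum_nat_const; apply: leq_sum => v _.
  exact: leq_trans (sum_level_hit _ _ _) (query_le_step_cost _ _ _).
set H := \sum_(i < L) _; set T := \sum_x _ => leH ineq.
have pos : 0 < m * lam by rewrite muln_gt0 m_gt0.
rewrite -(leq_pmul2l pos).
apply: leq_trans (_ : L * (m * m * lam * 2 ^ m) <= _).
  by rewrite leq_eqVlt; apply/orP; left; apply/eqP; lia.
apply: leq_trans ineq _; move: leH leLlam; move: (2 ^ k) => q leH leL'.
have : 512 * lam * H <= 512 * lam * (3 * q * T) by rewrite leq_mul2l leH orbT.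
have : L * (4 * q * T) <= lam * (4 * q * T) by rewrite leq_mul2r leL' orbT.
lia.
Qed.

Lemma exists_costly_input : exists x, L * m <= 1540 * cost_after D M0 (ops x m).
Proof.
have [/existsP//|/existsPn small] :=
  boolP [exists x, L * m <= 1540 * cost_after D M0 (ops x m)].
have cardX : #|{set 'I_m}| = 2 ^ m.
  by rewrite -cardsT -powersetT card_powerset cardsT card_ord.
have : \sum_x (1540 * total x).+1 <= \sum_(x : {set 'I_m}) L * m.
  by apply: leq_sum => x _; rewrite -cost_ops ltnNge small.
rewrite sum_nat_const cardX; under eq_bigr do rewrite -addn1.
rewrite big_split /= sum1_card cardX -big_distrr /=.
rewrite [leqRHS]mulnC => hi; have := leq_trans hi sum_total_ge.
by rewrite -[leqRHS]addn0 leq_add2l leqNgt expn_gt0.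
Qed.

End Levels.
End Adversary.

(** * Choice of parameters and the lower bound *)

Lemma costly_sequence n w k be L lam (D : DS n w) :
  4 * 2 ^ k <= n -> correct D -> 0 < be -> 0 < lam -> be * L <= k -> L <= lam ->
  2 * (2 * k + 2 * (2 * w + 1) * lam + 2) <= 2 ^ be ->
  exists p : parent_fn n, is_forest p /\
  exists s, size s = n /\ legal p s /\ L * 2 ^ k <= 1540 * cost D p s.
Proof.
move=> le_mn Dok be0 lam0 leL leLlam be_big.
have m_gt0 : 0 < 2 ^ k by rewrite expn_gt0.
have n_gt0 : 0 < n by lia.
pose v0 := Ordinal n_gt0.
have [x Hx] := exists_costly_input v0 le_mn Dok be0 lam0 leL leLlam be_big.
pose p0 := caterpillar (2 ^ k) v0.
exists p0; split; first exact: caterpillar_forest.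
set l := ops _ _ _ _ in Hx.
(* The adversary uses at most [2 * 2 ^ k <= n] operations; queries, always legal, pad the sequence
   to length [n]. *)
exists (l ++ [seq SubtreeSum v | v <- nseq (n - size l) v0]); split; [|split].
- rewrite size_cat size_map size_nseq subnKC //.
  apply: leq_trans; first exact: size_ops.
  by lia.
- by apply: legal_cat; [exact: legal_ops|exact: legal_queries].
- rewrite /cost exec_cost cost_after_cat mulnDr.
  exact: leq_trans Hx (leq_addr _ _).
Qed.

Lemma leq_6mul_exp2 j : 5 <= j -> 6 * j <= 2 ^ j.
Proof.
move=> le5; rewrite -(subnKC le5); elim: (j - 5) => // d IH.
by rewrite addnS expnS; lia.
Qed.

Theorem theorem7 :
  forall C : nat, exists c N : nat, 0 < c /\
  forall n w : nat, N <= n ->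
  trunc_log 2 n <= w <= C * trunc_log 2 n ->
  forall D : DS n w, correct D ->
  exists p : parent_fn n, is_forest p /\
  exists s : seq (op n), size s = n /\ legal p s /\
    n * trunc_log 2 n <= c * cost D p s * trunc_log 2 (trunc_log 2 n).
Proof.
(* Here [96 = 8 * 12], from [n <= 8 * 2 ^ k] and [l <= 12 * (L * j)] below; the threshold gives
   [64 * C + 200 <= l]. *)
move=> C; exists (96 * 1540), (2 ^ (64 * C + 200)); split=> // n w le_n.
have n_gt0 : 0 < n by apply: leq_trans le_n; rewrite expn_gt0.
have [leln ltln] := andP (trunc_log_bounds (isT : 1 < 2) n_gt0).
have le_l : 64 * C + 200 <= trunc_log 2 n by apply: trunc_log_max.
move: (trunc_log 2 n) leln ltln le_l => l leln ltln le_l /andP[_ lew] D Dok.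
have l_gt0 : 0 < l by lia.
have [lell ltll] := andP (trunc_log_bounds (isT : 1 < 2) l_gt0).
have le7 : 7 <= trunc_log 2 l by apply: trunc_log_max; lia.
move: (trunc_log 2 l) lell ltll le7 => j lell ltll le7.
have [k El] : exists k, l = k.+2 by exists l.-2; lia.
have le6 : 6 * j <= l by apply: leq_trans lell; apply: leq_6mul_exp2; lia.
(* With [be = 3 * j], interval lengths grow by about the cube of [l] per level. *)
pose L := k %/ (3 * j).
have L_gt0 : 0 < L by rewrite divn_gt0; lia.
have le_mn : 4 * 2 ^ k <= n.
  by apply: leq_trans leln; rewrite El !expnS mulnA.
have leLk : 3 * j * L <= k by rewrite mulnC leq_divM.
have leLl : L <= l by apply: leq_trans (leq_div _ _) _; lia.
(* With [lam = l] and [w <= C * l] the left side is quadratic in [l], while [2 ^ (3 * j)] is at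
   least [l ^ 3 / 8]. *)
have big : 2 * (2 * k + 2 * (2 * w + 1) * l + 2) <= 2 ^ (3 * j).
  have l3 : l * l * l <= 8 * 2 ^ (3 * j).
    have lel : l <= 2 * 2 ^ j by rewrite -expnS ltnW.
    apply: leq_trans (leq_mul (leq_mul lel lel) lel) _.
    rewrite (mulnC 3) expnM !expnS expn0; lia.
  rewrite -(@leq_pmul2l 8) //; apply: leq_trans l3.
  have h1 : w * l <= C * l * l by rewrite leq_mul2r lew orbT.
  have h2 : (64 * C + 200) * (l * l) <= l * (l * l) by rewrite leq_mul2r le_l orbT.
  have h3 : l <= l * l by rewrite leq_pmulr.
  clear -h1 h2 h3 El l_gt0.
  have h4 : k <= l by lia.
  have -> : l * l * l = l * (l * l) by rewrite mulnA.
  by apply: leq_trans h2; lia.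
have [|p [pF [s [sz [ls Hs]]]]] := costly_sequence le_mn Dok _ l_gt0 leLk leLl big.
  by lia.
exists p; split=> //; exists s; split=> //; split=> //.
have lek : k < 2 * L * (3 * j).
  have := ltn_ceil k (_ : 0 < 3 * j); rewrite -/L => /(_ ltac:(lia)) H.
  apply: leq_trans H _; rewrite leq_mul2r; lia.
have len : n <= 8 * 2 ^ k.
  by apply: ltnW; apply: leq_trans ltln _; rewrite El !expnS !mulnA.
have lel : l <= 12 * (L * j) by lia.
apply: leq_trans (leq_mul len lel) _.
have := leq_mul (leqnn (96 * j)) Hs; move: (cost _ _ _) (2 ^ k) => T q; lia.
Qed.
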